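(* Let $N\ge 1$, let $\varphi\in H^1(\mathbb{T})$ be real-valued with zero mean, $\int_{\mathbb{T}}\varphi(x)\,dx=0$, let $f:\mathbb{R}^d\to\mathbb{R}^d$ be smooth, and let $\lambda_a,\lambda_x,\lambda_b\ge 0$. Let $\theta(t)=\{a_i(t),x_i(t),b(t)\}_{i=1}^N$, with $a_i(t)\in\mathbb{R}^d$, $x_i(t)\in\mathbb{T}$, $b(t)\in\mathbb{R}^d$, be a differentiable parameter curve on a time interval such that at every time $t$ the derivative $\dot\theta(t)$ is a minimizer, over all $\dot a_i\in\mathbb{R}^d$, $\dot x_i\in\mathbb{R}$, $\dot b\in\mathbb{R}^d$, of $$\int_{\mathbb{T}}\Big|\sum_{i=1}^{N}\big[\dot a_i\,\varphi(x-x_i(t))-a_i(t)\,\dot x_i\,\varphi'(x-x_i(t))\big]+\dot b+\partial_x f\big(q(x;\theta(t))\big)\Big|^2dx+\lambda_a\sum_{i=1}^N|\dot a_i|^2+\lambda_x\sum_{i=1}^N|\dot x_i|^2+\lambda_b|\dot b|^2,$$ where $q(x;\theta(t))=\sum_{i=1}^N a_i(t)\varphi(x-x_i(t))+b(t)$. Then $\dot b(t)=0$ for all $t$, so that $b(t)$ is constant, and the total quantity $\int_{\mathbb{T}}q(x;\theta(t))\,dx=b(t)$ is exactly conserved in time.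
   Context: $\mathbb{T}=\mathbb{R}/\mathbb{Z}$ is the one-dimensional torus. The minimization defines the evolution of the SPIKE method for the conservation law $\partial_t q+\partial_x f(q)=0$ on $\mathbb{T}$: the first integral is the squared $L^2$ norm of the strong-form PDE residual and the remaining terms are Tikhonov regularization. *)

(* Defs.v *)
From HB Require Import structures.
From mathcomp Require Import all_boot all_order all_algebra.
From mathcomp Require Import all_classical all_reals all_analysis.

Set Implicit Arguments.
Unset Strict Implicit.
Unset Printing Implicit Defensive.

Import Order.TTheory GRing.Theory Num.Theory.
Import numFieldNormedType.Exports.

Local Open Scope classical_set_scope.
Local Open Scope ring_scope.

(* Functions on the torus T = R/Z are 1-periodic functions on R; integrals over
   T are Lebesgue integrals over [0, 1], a fundamental domain up to a null
   set. *)
Definition intT (R : realType) (u : R -> R) : \bar R :=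
  \int[lebesgue_measure]_(x in `[0, 1]) (u x)%:E.

Definition L2T (R : realType) (u : R -> R) : Prop :=
  [/\ periodic u 1, measurable_fun setT u &
      lebesgue_measure.-integrable `[0, 1] (fun x => (u x ^+ 2)%:E)].

Definition testT (R : realType) (psi : R -> R) : Prop :=
  periodic psi 1 /\ forall (n : nat) (x : R), derivable (derive1n n psi) x 1.

Definition is_wderiv (R : realType) (u v : R -> R) : Prop :=
  [/\ L2T u, L2T v &
      forall psi : R -> R, testT psi ->
        intT (fun x => u x * derive1 psi x) =
        (- intT (fun x => v x * psi x)%R)%E].

Definition H1T (R : realType) (u : R -> R) : Prop :=
  exists v : R -> R, is_wderiv u v.

(* The weak derivative is unique only almost everywhere, so this is some
   representative of it; like [derive1], the operator is total, and its value
   (here 0) is meaningless when u is not in H^1(T). *)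
Definition wderiv (R : realType) (u : R -> R) : R -> R :=
  xget (cst 0) [set v | is_wderiv u v].

Definition wderiv_vec (R : realType) (d : nat) (u : R -> 'rV[R]_d) (x : R) :
  'rV[R]_d := \row_j wderiv (fun y => u y ord0 j) x.

Fixpoint Ck (R : realType) (V W : normedModType R) (k : nat) (f : V -> W) :
  Prop :=
  if k is k'.+1 then
    (forall x, differentiable f x) /\ (forall v, Ck k' (fun x => 'D_v f x))
  else continuous f.

Definition smooth (R : realType) (V W : normedModType R) (f : V -> W) : Prop :=
  forall k, Ck k f.

(* The library norm on 'rV[R]_d is the sup norm, hence a separate Euclidean
   one. *)
Definition sqnorm (R : realType) (d : nat) (v : 'rV[R]_d) : R :=
  \sum_j v ord0 j ^+ 2.

(* v is the derivative of g at t along the set I, so one-sided at those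
   endpoints of I that belong to I. *)
Definition deriv_on (R : realType) (V : normedModType R) (I : set R)
    (g : R -> V) (t : R) (v : V) : Prop :=
  (fun s => (s - t)^-1 *: (g s - g t)) @ within I t^' --> v.

(* The centres x_i in T are given by representatives in R; all the quantities
   below depend on them only modulo 1 because phi is 1-periodic. *)
Definition spike_q (R : realType) (N d : nat) (phi : R -> R)
    (a : 'I_N -> 'rV[R]_d) (x : 'I_N -> R) (b : 'rV[R]_d) (y : R) : 'rV[R]_d :=
  \sum_(i < N) phi (y - x i) *: a i + b.

Definition spike_residual (R : realType) (N d : nat) (phi : R -> R)
    (f : 'rV[R]_d -> 'rV[R]_d)
    (a : 'I_N -> 'rV[R]_d) (x : 'I_N -> R) (b : 'rV[R]_d)
    (da : 'I_N -> 'rV[R]_d) (dx : 'I_N -> R) (db : 'rV[R]_d) (y : R) :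
  'rV[R]_d :=
  \sum_(i < N) (phi (y - x i) *: da i - (dx i * wderiv phi (y - x i)) *: a i)
  + db + wderiv_vec (fun z => f (spike_q phi a x b z)) y.

Definition spike_objective (R : realType) (N d : nat) (phi : R -> R)
    (f : 'rV[R]_d -> 'rV[R]_d) (la lx lb : R)
    (a : 'I_N -> 'rV[R]_d) (x : 'I_N -> R) (b : 'rV[R]_d)
    (da : 'I_N -> 'rV[R]_d) (dx : 'I_N -> R) (db : 'rV[R]_d) : \bar R :=
  (intT (fun y => sqnorm (spike_residual phi f a x b da dx db y)) +
   (la * (\sum_(i < N) sqnorm (da i)) + lx * (\sum_(i < N) dx i ^+ 2)
    + lb * sqnorm db)%R%:E)%E.

(* Main.v *)
Require Import Defs.
From HB Require Import structures.
From mathcomp Require Import all_boot all_order all_algebra.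
From mathcomp Require Import all_classical all_reals all_analysis.
From mathcomp Require Import measurable_realfun ring lra.

Set Implicit Arguments.
Unset Strict Implicit.
Unset Printing Implicit Defensive.

Import Order.TTheory GRing.Theory Num.Theory.
Import numFieldNormedType.Exports.

Local Open Scope classical_set_scope.
Local Open Scope ring_scope.

(** Every [wderiv u] has zero mean: test a weak derivative against the
constant 1, and when there is none the operator returns 0. With the zero mean
of [phi] and its translates, the residual is [r + db] with [r] of zero mean in
L^2, so by Pythagoras the objective is its value at [db = 0] plus
[(1 + lb) |db|^2], and a minimizer has [db = 0]. *)

(** * Translation invariance of integrals over a period *)

Lemma lebesgue_measure_shift (R : realType) (c : R) (A : set R) :
  measurable A ->
  pushforward lebesgue_measure (+%R^~ c : _ -> measurableTypeR R) A =
  lebesgue_measure A.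
Proof.
have mf : measurable_fun [set: R] (+%R^~ c : R -> measurableTypeR R).
  exact: measurable_funD.
(* By uniqueness of Lebesgue measure it suffices to compare on half-open intervals, whose preimages
   are translates of the same length. *)
move=> mA; apply/esym/lebesgue_measure_unique => //= _ [[u v]] _ <-.
rewrite /pushforward (_ : _ @^-1` _ = `]u - c, v - c]%classic); last first.
  by apply/seteqP; split=> y; rewrite /= !in_itv /= ltrBlDr lerBrDr.
rewrite !lebesgue_measure_itv /= !lte_fin ltrD2r.
by case: ifP => // _; rewrite -!EFinD; congr EFin; ring.
Qed.

Lemma integral_shift (R : realType) (c : R) (D : set R) (u : R -> \bar R) :
  measurable D -> measurable_fun [set: R] u ->
  (\int[lebesgue_measure]_(y in D) u y =
   \int[lebesgue_measure]_(y in [set y | D (y + c)%R]) u (y + c)%R)%E.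
Proof.
move=> mD mu.
have mf : measurable_fun [set: R] (+%R^~ c : R -> measurableTypeR R).
  exact: measurable_funD.
(* Change of variables along a pushforward is first done for nonnegative integrands; positive and
   negative parts then give the signed case. *)
have ge0_shift (v : R -> \bar R) : measurable_fun [set: R] v ->
    (forall y, 0 <= v y)%E ->
    (\int[lebesgue_measure]_(y in D) v y =
     \int[lebesgue_measure]_(y in [set y | D (y + c)%R]) v (y + c)%R)%E.
  move=> mv v0.
  rewrite (_ : [set y | D (y + c)] =
    (+%R^~ c : _ -> measurableTypeR R) @^-1` D)//.
  rewrite -[RHS]ge0_integral_pushforward//=; last exact: measurable_funS mv.
  by apply: eq_measure_integral => //= A mA AD;
    exact/esym/lebesgue_measure_shift.
rewrite integralE [RHS]integralE.
have -> : (fun y => u (y + c)%R)^\+%E = (fun y => u^\+ (y + c)%R)%E.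
  by apply/funext => y; rewrite !funeposE.
have -> : (fun y => u (y + c)%R)^\-%E = (fun y => u^\- (y + c)%R)%E.
  by apply/funext => y; rewrite !funenegE.
congr (_ - _)%E.
  by apply: ge0_shift => //; exact: measurable_funepos.
by apply: ge0_shift => //; exact: measurable_funeneg.
Qed.

Lemma periodicz (R : realType) (T : Type) (u : R -> T) (n : int) (y : R) :
  (forall y, u (y + 1) = u y) -> u (y + n%:~R) = u y.
Proof.
move=> pu; have pn (k : nat) z : u (z + k%:R) = u z.
  by elim: k z => [|k IH] z; rewrite ?addr0// -addn1 natrD addrA pu IH.
case: n => n; first exact: pn.
by rewrite NegzE mulrNz -[in RHS](subrK n.+1%:R y) pn.
Qed.

(** By periodicity only the fractional part [r] of [c] matters. Translation by [r] carries [[0, 1 -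
    r[] onto [[r, 1[], and translation by [r - 1] carries [[1 - r, 1[] onto [[0, r[], so the two
    pieces of the period are merely exchanged. *)
Lemma integral_periodic_shift (R : realType) (c : R) (u : R -> \bar R) :
  measurable_fun [set: R] u -> (forall y, u (y + 1) = u y) ->
  (\int[lebesgue_measure]_(y in `[0%R, 1%R]) u (y + c)%R =
   \int[lebesgue_measure]_(y in `[0%R, 1%R]) u y)%E.
Proof.
move=> mu pu; pose r := c - (Num.floor c)%:~R.
have /andP[r0 r1] : 0 <= r < 1.
  by rewrite subr_ge0 ltrBlDl floor_le -[X in _ + X]/(1%:~R) -intrD floorD1_gt.
have uE y : u (y + c) = u (y + r).
  by rewrite -(periodicz (Num.floor c) (y + r))// /r -addrA subrK.
have mS (D : set R) : measurable_fun D u by exact: measurable_funTS.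
have mSr (D : set R) : measurable_fun D (fun y => u (y + r)).
  apply: measurable_funTS; apply: (measurableT_comp mu).
  exact: measurable_funD.
under eq_integral do rewrite uE.
(* Dropping the null endpoint 1 lets half-open pieces tile the period exactly. *)
have -> : (\int[lebesgue_measure]_(y in `[0%R, 1%R]) u (y + r)%R =
   \int[lebesgue_measure]_(y in `[0%R, 1%R[) u (y + r)%R)%E.
  by rewrite integral_itv_bndo_bndc.
have -> : (\int[lebesgue_measure]_(y in `[0%R, 1%R]) u y =
   \int[lebesgue_measure]_(y in `[0%R, 1%R[) u y)%E.
  by rewrite integral_itv_bndo_bndc.
have split_itv (v : R -> \bar R) (m : R) : (forall D, measurable_fun D v) ->
    0 <= m <= 1 ->
    (\int[lebesgue_measure]_(y in `[0%R, 1%R[) v y =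
     \int[lebesgue_measure]_(y in `[0%R, m[) v y +
     \int[lebesgue_measure]_(y in `[m, 1%R[) v y)%E.
  move=> mv /andP[m0 m1]; rewrite -integral_setU//.
    congr (integral _ _ _); apply/seteqP; split=> y /=; rewrite !in_itv /=.
      by move=> /andP[-> ->]; rewrite andbT /=; apply/orP;
        rewrite orbC leNgt orNb.
    by move=> [/andP[-> /lt_le_trans ->]|/andP[/(le_trans m0) -> ->]].
    exact: mv.
  apply/disj_setPS => y [] /=; rewrite !in_itv /= => /andP[_ ym] /andP[my _].
  by move: (lt_le_trans ym my); rewrite ltxx.
rewrite (split_itv (fun y => u (y + r)) (1 - r))//; last
  by rewrite subr_ge0 gerBl r0 ltW.
rewrite [RHS](split_itv u r)//; last by rewrite r0 ltW.
rewrite addeC; congr (_ + _)%E.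
  (* This piece wraps around the torus: the shift is [r - 1], and one period is added back through
     [pu]. *)
  rewrite [RHS](integral_shift (r - 1))//.
  rewrite (_ : [set y | `[0, r[%classic (y + (r - 1))] =
    `[1 - r, 1[%classic); last first.
    apply/seteqP; split=> y; rewrite /= !in_itv /= => /andP[h1 h2];
      apply/andP; split; lra.
  apply: eq_integral => y _.
  by rewrite -[RHS]pu; congr u; ring.
rewrite [RHS](integral_shift r)//.
congr (integral _ _ _).
apply/seteqP; split=> y; rewrite /= !in_itv /= => /andP[h1 h2];
  apply/andP; split; lra.
Qed.

(** * Square-integrable functions on the torus, their means and translates *)

Lemma lebesgue_measure_unit_itv (R : realType) :
  lebesgue_measure (`[0, 1] : set R) = 1%E.
Proof. by rewrite lebesgue_measure_itv /= lte_fin ltr01 oppr0 adde0. Qed.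

Lemma integrable_cst_unit_itv (R : realType) (k : R) :
  lebesgue_measure.-integrable `[0, 1] (fun=> k%:E).
Proof.
apply/integrableP; split; first exact: measurable_cst.
rewrite (integral_cst _ _ `|k%:E|%E)//.
by rewrite [X in (_ * X)%E]lebesgue_measure_unit_itv mule1 ltry.
Qed.

Lemma intT_cst (R : realType) (k : R) : intT (fun=> k) = k%:E.
Proof.
by rewrite /intT integral_cst// [X in (_ * X)%E]lebesgue_measure_unit_itv mule1.
Qed.

Lemma L2T_integrable (R : realType) (u : R -> R) :
  L2T u -> lebesgue_measure.-integrable `[0, 1] (EFin \o u).
Proof.
move=> [_ mu iu2].
apply: le_integrable (integrableD _ (integrable_cst_unit_itv 1) iu2) => //.
  by apply/measurable_EFinP; exact: measurable_funTS.
move=> y _ /=; rewrite lee_fin.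
(* Expanding this square gives [2 * |u| <= 1 + u ^+ 2], and the right-hand side is integrable on a
   set of measure 1. *)
have := sqr_ge0 (`|u y| - 1); rewrite -[u y ^+ 2]real_normK ?num_real// => h.
rewrite [leRHS]ger0_norm; nra.
Qed.

Lemma L2T_cst (R : realType) (k : R) : L2T (fun=> k).
Proof. by split=> //; exact: integrable_cst_unit_itv. Qed.

Lemma L2T_lin (R : realType) (k : R) (u v : R -> R) :
  L2T u -> L2T v -> L2T (fun y => k * u y + v y).
Proof.
move=> [pu mu iu] [pv mv iv].
have muv : measurable_fun [set: R] (fun y => k * u y + v y).
  by apply: measurable_funD => //; exact: measurable_funM.
split=> //; first by move=> y; rewrite pu pv.
apply: le_integrable (integrableD _ (integrableZl _ (2 * k ^+ 2) iu)
  (integrableZl _ 2 iv)) => //.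
  by apply/measurable_EFinP/measurable_funTS; exact: measurable_funX.
move=> y _ /=; rewrite lee_fin.
(* This square yields the domination of [(k * u + v) ^+ 2] by [2 * k ^+ 2 * u ^+ 2 + 2 * v ^+ 2]. *)
have h := sqr_ge0 (k * u y - v y).
have h1 : 0 <= (k * u y) ^+ 2 := sqr_ge0 _.
have h2 := sqr_ge0 (v y).
rewrite !ger0_norm ?sqr_ge0//; nra.
Qed.

Lemma intT_lin (R : realType) (k : R) (u v : R -> R) :
  L2T u -> L2T v ->
  intT (fun y => k * u y + v y) = (k%:E * intT u + intT v)%E.
Proof.
move=> Lu Lv; have iu := L2T_integrable Lu; have iv := L2T_integrable Lv.
rewrite /intT -integralZl// -integralD//; exact: integrableZl.
Qed.

Lemma intT_shift (R : realType) (c : R) (u : R -> R) :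
  periodic u 1 -> measurable_fun [set: R] u ->
  intT (fun y => u (y - c)) = intT u.
Proof.
move=> pu mu.
apply: (@integral_periodic_shift _ (- c) (EFin \o u)).
  exact/measurable_EFinP.
by move=> y; rewrite /= pu.
Qed.

Lemma L2T_shift (R : realType) (c : R) (u : R -> R) :
  L2T u -> L2T (fun y => u (y - c)).
Proof.
move=> [pu mu /integrableP[_ iu]].
have mc : measurable_fun [set: R] (fun y => u (y - c)).
  by apply: (measurableT_comp mu); exact: measurable_funB.
split=> //; first by move=> y; rewrite addrAC pu.
apply/integrableP; split.
  by apply/measurable_EFinP/measurable_funTS; exact: measurable_funX.
rewrite (@integral_periodic_shift _ (- c) (fun y => `|(u y ^+ 2)%:E|%E))//.
  apply: measurableT_comp => //; apply/measurable_EFinP.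
  exact: measurable_funX.
by move=> y; rewrite pu.
Qed.

(** The orthogonal complement of the constants. It is stable under linear combinations and
    translations and contains every [wderiv u], hence each coordinate of the residual apart from its
    [db] term. *)
Definition L2T0 (R : realType) (u : R -> R) := L2T u /\ intT u = 0%E.

Lemma L2T0_0 (R : realType) : L2T0 (fun=> 0 : R).
Proof. by split; [exact: L2T_cst | rewrite intT_cst]. Qed.

Lemma L2T0_lin (R : realType) (k : R) (u v : R -> R) :
  L2T0 u -> L2T0 v -> L2T0 (fun y => k * u y + v y).
Proof.
move=> [Lu u0] [Lv v0]; split; first exact: L2T_lin.
by rewrite intT_lin// u0 v0 mule0 adde0.
Qed.

Lemma L2T0_sum (R : realType) (J : Type) (s : seq J) (u : J -> R -> R) :
  (forall i, L2T0 (u i)) -> L2T0 (fun y => \sum_(i <- s) u i y).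
Proof.
move=> Lu; elim: s => [|i s IH].
  by under eq_fun do rewrite big_nil; exact: L2T0_0.
have := L2T0_lin 1 (Lu i) IH; congr L2T0; apply/funext => y.
by rewrite big_cons mul1r.
Qed.

Lemma L2T0_shift (R : realType) (c : R) (u : R -> R) :
  L2T0 u -> L2T0 (fun y => u (y - c)).
Proof.
move=> [Lu u0]; split; first exact: L2T_shift.
by case: Lu => pu mu _; rewrite intT_shift.
Qed.

Lemma testT_cst (R : realType) (k : R) : testT (fun=> k).
Proof.
have derE (n : nat) : exists l, derive1n n (fun=> k) = cst l.
  elim: n => [|n [l IH]]; first by exists k.
  by exists 0; rewrite derive1nS IH; apply/funext => y; rewrite derive1_cst.
split=> // n y; have [l ->] := derE n; exact: derivable_cst.
Qed.

Lemma wderiv_L2T0 (R : realType) (u : R -> R) : L2T0 (wderiv u).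
Proof.
rewrite /wderiv; case: xgetP => [v _ [_ Lv /(_ _ (testT_cst 1))]|_];
  last exact: L2T0_0.
(* The derivative of the constant test function vanishes, so the tested identity reduces to
   [0 = - intT v]. *)
rewrite (_ : (fun y => _) = fun=> 0); last first.
  by apply/funext => y; rewrite derive1_cst mulr0.
rewrite intT_cst => /esym/eqP; rewrite oppe_eq0 => /eqP.
by under eq_fun do rewrite mulr1.
Qed.

(** Zero-mean functions are orthogonal to constants, so the cross term [2 * c * intT u] drops out;
    the period has length 1, so the constant contributes exactly [c ^+ 2]. *)
Lemma intT_sqrD (R : realType) (u : R -> R) (c : R) :
  L2T0 u -> intT (fun y => (u y + c) ^+ 2) =
            (intT (fun y => u y ^+ 2)%R + (c ^+ 2)%R%:E)%E.
Proof.
move=> [Lu u0]; have iu := L2T_integrable Lu; case: (Lu) => _ _ iu2.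
have ic := integrable_cst_unit_itv (c ^+ 2).
transitivity (\int[lebesgue_measure]_(y in `[0%R, 1%R])
  ((u y ^+ 2)%R%:E + ((2 * c)%R%:E * (u y)%:E + (c ^+ 2)%R%:E)))%E.
  by apply: eq_integral => y _; rewrite -EFinM -!EFinD; congr EFin; ring.
rewrite !integralD//; last 2 first.
- exact: integrableZl.
- by apply: integrableD => //; exact: integrableZl.
by rewrite integralZl// -!/(intT _) u0 mule0 add0e intT_cst.
Qed.

(** * Curves with vanishing derivative on an interval *)

Lemma deriv_on_coord (R : realType) (d : nat) (I : set R) (g : R -> 'rV[R]_d)
    (t : R) (v : 'rV[R]_d) (j : 'I_d) :
  deriv_on I g t v ->
  deriv_on I (fun s => g s ord0 j : R^o) t (v ord0 j).
Proof.
move=> gv; rewrite /deriv_on.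
rewrite (_ : (fun s => _) = (fun w : 'rV[R]_d => w ord0 j : R^o) \o
    (fun s => (s - t)^-1 *: (g s - g t))); last first.
  by apply/funext => s; rewrite /= !mxE.
exact: cvg_comp gv (@coord_continuous R 1 d ord0 j v).
Qed.

(** The difference quotient estimate multiplied out, which also makes sense at [s = t], a point that
    the punctured limit omits. *)
Lemma deriv_on0_le (R : realType) (I : set R) (g : R -> R) (t e : R) :
  deriv_on I (g : R -> R^o) t 0 -> 0 < e ->
  \forall s \near t, I s -> `|g s - g t| <= e * `|s - t|.
Proof.
move=> /cvgrPdist_lt g0 e0.
have h0 : \forall s \near t, s != t -> I s ->
  `|0 - (s - t)^-1 *: (g s - g t : R^o)| < e := g0 e e0.
move: h0; apply: filterS => s h Is; have [->|st] := eqVneq s t.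
  by rewrite !subrr normr0 mulr0.
have := h st Is; rewrite sub0r normrN normrZ normfV => /ltW.
by rewrite ler_pdivrMl ?normr_gt0 ?subr_eq0// mulrC.
Qed.

(** Mean value theorem on [[s, t]] with derivative 0. It asks for continuity up to the endpoints but
    two-sided derivatives only inside, so one-sided derivatives at the ends of [I] suffice. *)
Lemma deriv_on0_cst (R : realType) (I : set R) (g : R -> R) (s t : R) :
  is_interval I -> (forall t, I t -> deriv_on I (g : R -> R^o) t 0) ->
  I s -> I t -> g s = g t.
Proof.
move=> hI g0; wlog st : s t / s < t.
  move=> h Is It; case: (ltgtP s t) => [st|ts|->//]; first exact: h.
  by apply/esym; exact: h.
move=> Is It.
have sub z : z \in `[s, t] -> I z.
  by rewrite in_itv /= => zst; exact: (hI s t).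
have [||c _] := @MVT R g (fun=> 0) s t st; last first.
- by rewrite mul0r => /eqP; rewrite subr_eq0 => /eqP.
(* The estimate with constant 1 gives [|g u - g z| <= |u - z|] for [u] in [[s, t]] near [z],
   endpoints included. *)
- apply/subspace_continuousP => z /= zst.
  have Iz := sub z zst.
  apply/cvgrPdist_le => e e0.
  rewrite near_withinE; near=> u => ust.
  have h : `|g u - g z| <= 1 * `|u - z|.
    by move: (sub u ust); near: u; exact: deriv_on0_le (g0 z Iz) ltr01.
  rewrite distrC (le_trans h)// mul1r distrC; near: u.
  exact: cvgr_dist_le.
(* Every point near an interior [z] lies in [I], so the derivative along [I] is the ordinary one;
   the estimate is carried over to increments [h] by continuity of [h + z] at 0. *)
- move=> z zst.
  have Iz : I z by apply: sub; exact: subset_itv_oo_cc zst.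
  have lim0 : h^-1 *: (g (h *: (1 : R) + z) - g z) @[h --> 0^'] --> (0 : R^o).
    apply/cvgrPdist_le => e e0.
    have nb : \forall u \near z, `|g u - g z| <= e * `|u - z|.
      near=> u; have Iu : I u.
        apply: sub; apply: subset_itv_oo_cc; near: u.
        exact: near_in_itvoo.
      by move: Iu; near: u; exact: deriv_on0_le (g0 z Iz) e0.
    have : \forall h \near (0 : R), `|g (h + z) - g z| <= e * `|h + z - z|.
      have cz : h + z @[h --> (0 : R)] --> z.
        rewrite -[X in _ --> X]add0r.
        by apply: cvgD; [exact: cvg_id | exact: cvg_cst].
      exact: cz nb.
    move=> nb0; near=> h.
    have h0 : h != 0 by near: h; exact: nbhs_dnbhs_neq.
    have /[!addrK] hle : `|g (h + z) - g z| <= e * `|h + z - z|.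
      by near: h; exact: nbhs_dnbhs.
    rewrite sub0r normrN normrZ normfV ler_pdivrMl ?normr_gt0//.
    by rewrite scaler1 mulrC.
  apply: DeriveDef; first by apply/cvg_ex; exists 0.
  exact/cvg_lim.
Unshelve. all: by end_near. Qed.

(** * The residual and the minimizing [db] *)

Lemma residual_L2T0 (R : realType) (N d : nat) (phi : R -> R)
    (f : 'rV[R]_d -> 'rV[R]_d) (a : 'I_N -> 'rV[R]_d) (x : 'I_N -> R)
    (b : 'rV[R]_d) (da : 'I_N -> 'rV[R]_d) (dx : 'I_N -> R) (j : 'I_d) :
  L2T0 phi ->
  L2T0 (fun y => spike_residual phi f a x b da dx 0 y ord0 j).
Proof.
move=> phi0.
(* The trailing [+ 0] gives a plain scalar multiple the shape [k * u + v] of [L2T0_lin]. *)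
pose w i y := da i ord0 j * phi (y - x i) +
  (- (dx i * a i ord0 j) * wderiv phi (y - x i) + 0).
have Lw i : L2T0 (w i).
  apply: L2T0_lin; first exact: L2T0_shift.
  by apply: L2T0_lin; [exact/L2T0_shift/wderiv_L2T0 | exact: L2T0_0].
have := L2T0_lin 1 (L2T0_sum (index_enum 'I_N) Lw)
  (wderiv_L2T0 (fun y => f (spike_q phi a x b y) ord0 j)).
congr L2T0; apply/funext => y.
rewrite /spike_residual addr0 !mxE summxE mul1r; congr (_ + _).
by apply: eq_bigr => i _; rewrite !mxE /w; ring.
Qed.

Lemma residual_split (R : realType) (N d : nat) (phi : R -> R)
    (f : 'rV[R]_d -> 'rV[R]_d) (a : 'I_N -> 'rV[R]_d) (x : 'I_N -> R)
    (b : 'rV[R]_d) (da : 'I_N -> 'rV[R]_d) (dx : 'I_N -> R) (db : 'rV[R]_d)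
    (y : R) :
  spike_residual phi f a x b da dx db y =
  spike_residual phi f a x b da dx 0 y + db.
Proof. by rewrite /spike_residual addr0 addrAC. Qed.

Lemma intT_sqnorm (R : realType) (d : nat) (u : R -> 'rV[R]_d) :
  (forall j, L2T (fun y => u y ord0 j)) ->
  intT (fun y => sqnorm (u y)) =
  (\sum_(j < d) intT (fun y => u y ord0 j ^+ 2)%R)%E.
Proof.
move=> Lu; rewrite /intT; under eq_integral do rewrite /sqnorm -sumEFin.
by rewrite integral_sum// => j; case: (Lu j).
Qed.

Lemma intT_sqnormD (R : realType) (d : nat) (u : R -> 'rV[R]_d)
    (c : 'rV[R]_d) :
  (forall j, L2T0 (fun y => u y ord0 j)) ->
  intT (fun y => sqnorm (u y + c)) =
  (intT (fun y => sqnorm (u y)) + (sqnorm c)%:E)%E.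
Proof.
move=> Lu.
have Luc j : L2T (fun y => (u y + c) ord0 j).
  have := L2T_lin 1 (Lu j).1 (L2T_cst (c ord0 j)).
  by congr L2T; apply/funext => y; rewrite mxE mul1r.
rewrite !intT_sqnorm//; last by move=> j; case: (Lu j).
rewrite -sumEFin -big_split /=; apply: eq_bigr => j _.
by rewrite -intT_sqrD//; congr intT; apply/funext => y; rewrite mxE.
Qed.

(** Finiteness allows the common integral to be cancelled when two extended-real objectives are
    compared. *)
Lemma intT_sqnorm_fin_num (R : realType) (d : nat) (u : R -> 'rV[R]_d) :
  (forall j, L2T (fun y => u y ord0 j)) ->
  intT (fun y => sqnorm (u y)) \is a fin_num.
Proof.
move=> Lu; rewrite intT_sqnorm//.
apply: (big_ind (fun z : \bar R => z \is a fin_num)) => [//|p q ? ?|j _];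
  first by rewrite fin_numD; exact/andP.
by apply: integrable_fin_num => //; case: (Lu j).
Qed.

Lemma sqnorm_ge0 (R : realType) (d : nat) (v : 'rV[R]_d) : 0 <= sqnorm v.
Proof. by apply: sumr_ge0 => j _; exact: sqr_ge0. Qed.

Lemma sqnorm_eq0 (R : realType) (d : nat) (v : 'rV[R]_d) :
  sqnorm v = 0 -> v = 0.
Proof.
move=> v0; apply/rowP => j; apply/eqP; rewrite mxE -sqrf_eq0; apply/eqP.
by apply: (psumr_eq0P _ v0) => // i _; exact: sqr_ge0.
Qed.

(** A single competitor is enough: keep [da] and [dx] and replace [db] by 0. After cancellation the
    inequality reads [(1 + lb) * sqnorm db <= 0]. *)
Lemma spike_minimizer_db0 (R : realType) (N d : nat) (phi : R -> R)
    (f : 'rV[R]_d -> 'rV[R]_d) (la lx lb : R) (a : 'I_N -> 'rV[R]_d)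
    (x : 'I_N -> R) (b : 'rV[R]_d) (da : 'I_N -> 'rV[R]_d) (dx : 'I_N -> R)
    (db : 'rV[R]_d) :
  L2T0 phi -> 0 <= lb ->
  (spike_objective phi f la lx lb a x b da dx db <=
   spike_objective phi f la lx lb a x b da dx 0)%E ->
  db = 0.
Proof.
move=> phi0 lb0; pose r := spike_residual phi f a x b da dx 0.
have Lr j : L2T0 (fun y => r y ord0 j) by exact: residual_L2T0.
have sq0 : sqnorm (0 : 'rV[R]_d) = 0.
  by rewrite /sqnorm big1// => j _; rewrite mxE expr0n.
rewrite /spike_objective.
under [X in (intT X + _ <= _)%E]eq_fun do rewrite residual_split -/r.
rewrite intT_sqnormD// -/r.
have /fineK <- := intT_sqnorm_fin_num (fun j => (Lr j).1).
rewrite -!EFinD lee_fin sq0 mulr0 => le; apply: sqnorm_eq0.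
apply/eqP; rewrite eq_le sqnorm_ge0 andbT.
have := sqnorm_ge0 db; move: le; rewrite /r; nra.
Qed.

(** * The total quantity and its conservation *)

Lemma intT_spike_q (R : realType) (N d : nat) (phi : R -> R)
    (a : 'I_N -> 'rV[R]_d) (x : 'I_N -> R) (b : 'rV[R]_d) (j : 'I_d) :
  L2T0 phi -> intT (fun y => spike_q phi a x b y ord0 j) = (b ord0 j)%:E.
Proof.
move=> phi0.
have Ls i : L2T0 (fun y => a i ord0 j * phi (y - x i) + 0).
  by apply: L2T0_lin; [exact: L2T0_shift | exact: L2T0_0].
have [Lw w0] := L2T0_sum (index_enum 'I_N) Ls.
(* The translates of [phi] have zero mean, so only the constant [b] survives; the factor 1 matches
   the shape required by [intT_lin]. *)
transitivity (intT (fun y =>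
    1 * (\sum_(i < N) (a i ord0 j * phi (y - x i) + 0)) + b ord0 j)).
  congr intT; apply/funext => y; rewrite mul1r /spike_q mxE summxE.
  by congr (_ + _); apply: eq_bigr => i _; rewrite mxE addr0 mulrC.
by rewrite (intT_lin 1 Lw (L2T_cst _)) w0 mule0 add0e intT_cst.
Qed.

Theorem mainTheorem1 (R : realType) (N d : nat) (hN : (1 <= N)%N)
    (phi : R -> R) (hphi : H1T phi) (hphi0 : intT phi = 0%E)
    (f : 'rV[R]_d -> 'rV[R]_d) (hf : smooth f)
    (la lx lb : R) (hla : 0 <= la) (hlx : 0 <= lx) (hlb : 0 <= lb)
    (I : set R) (hI : is_interval I)
    (a : 'I_N -> R -> 'rV[R]_d) (x : 'I_N -> R -> R) (b : R -> 'rV[R]_d)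
    (da : 'I_N -> R -> 'rV[R]_d) (dx : 'I_N -> R -> R) (db : R -> 'rV[R]_d)
    (ha : forall (i : 'I_N) (t : R), I t -> deriv_on I (a i) t (da i t))
    (hx : forall (i : 'I_N) (t : R), I t ->
        deriv_on I (x i : R -> R^o) t (dx i t))
    (hb : forall t : R, I t -> deriv_on I b t (db t))
    (hmin : forall t : R, I t ->
        forall (da' : 'I_N -> 'rV[R]_d) (dx' : 'I_N -> R) (db' : 'rV[R]_d),
        (spike_objective phi f la lx lb (a^~ t) (x^~ t) (b t)
           (da^~ t) (dx^~ t) (db t)
         <= spike_objective phi f la lx lb (a^~ t) (x^~ t) (b t)
              da' dx' db')%E) :
  [/\ forall t : R, I t -> db t = 0,
      forall s t : R, I s -> I t -> b s = b t,
      forall (t : R) (j : 'I_d), I t ->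
        intT (fun y => spike_q phi (a^~ t) (x^~ t) (b t) y ord0 j)
        = (b t ord0 j)%:E
    & forall (s t : R) (j : 'I_d), I s -> I t ->
        intT (fun y => spike_q phi (a^~ s) (x^~ s) (b s) y ord0 j)
        = intT (fun y => spike_q phi (a^~ t) (x^~ t) (b t) y ord0 j)].
Proof.
have phi0 : L2T0 phi by split=> //; case: hphi => v [].
have db0 t : I t -> db t = 0.
  by move=> It; apply: (spike_minimizer_db0 phi0 hlb); exact: hmin.
have bE s t : I s -> I t -> b s = b t.
  (* The mean value argument concerns real-valued functions, so [b] is treated coordinate by
     coordinate. *)
  move=> Is It; apply/rowP => j.
  apply: (@deriv_on0_cst _ I (fun s => b s ord0 j)) => // u Iu.
  by have := deriv_on_coord (j := j) (hb u Iu); rewrite db0// mxE.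
split=> // [t j It | s t j Is It]; first exact: intT_spike_q.
by rewrite !intT_spike_q// (bE s t).
Qed.
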